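(* If $G$ and $H$ are (disjoint) graphs and $G+H$ denotes their join, then \[ \mathrm{gp}(G+H)=\max\{\omega(G)+\omega(H),\,\eta(G),\,\eta(H)\}=\max\{\omega(G)+\omega(H),\,\rho(G),\,\rho(H)\}. \]
   Context: Graphs are finite, undirected, simple and have at least one vertex. The join $G+H$ of disjoint graphs $G$ and $H$ has vertex set $V(G)\cup V(H)$ and edge set $E(G)\cup E(H)\cup\{xy:\ x\in V(G),\,y\in V(H)\}$. $\omega(G)$ is the number of vertices of a largest complete subgraph of $G$. $\eta(G)$ is the maximum order of an induced complete multipartite subgraph of the complement $\overline{G}$, where a complete multipartite graph is taken to have at least two (nonempty) partite sets, and $\eta(G)=0$ if no such induced subgraph exists. For a graph $G$, $d_G$ is the shortest-path distance, taken as infinite between different components. Complete subgraphs $Q$ and $Q'$ of $G$ are independent if $d_G(u,u')\ge 2$ for every $u\in V(Q)$ and every $u'\in V(Q')$. $\rho(G)$ denotes the maximum number of vertices in a union of pairwise independent complete subgraphs of $G$ (the union of a single complete subgraph being allowed). A $u,v$-geodesic is a $u,v$-path of length $d_G(u,v)$. A set $S\subseteq V(G)$ is a general position set of $G$ if no vertex of $S$ lies on a geodesic between two other vertices of $S$. The general position number $\mathrm{gp}(G)$ is the maximum cardinality of a general position set of $G$. *)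

(* Defs.v *)
From mathcomp Require Import all_boot.

Set Implicit Arguments.
Unset Strict Implicit.
Unset Printing Implicit Defensive.

(* Non-emptiness of the vertex set is not part of the record, so that induced
   subgraphs can be formed on any set of vertices; it is stated as a hypothesis
   where it matters. *)
Record sgraph := SGraph {
  vertex :> finType;
  edge : rel vertex;
  edge_sym : symmetric edge;
  edge_irrefl : irreflexive edge }.

Section Complement.
Variable G : sgraph.

Definition compl_edge : rel G := fun x y => (x != y) && ~~ edge x y.

Lemma compl_edge_sym : symmetric compl_edge.
Proof. by move=> x y; rewrite /compl_edge eq_sym edge_sym. Qed.

Lemma compl_edge_irrefl : irreflexive compl_edge.
Proof. by move=> x; rewrite /compl_edge eqxx. Qed.

Definition complement : sgraph := SGraph compl_edge_sym compl_edge_irrefl.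
End Complement.

Section Induced.
Variables (G : sgraph) (S : {set G}).

Definition induced_edge : rel {x : G | x \in S} :=
  fun x y => edge (val x) (val y).

Lemma induced_edge_sym : symmetric induced_edge.
Proof. by move=> x y; rewrite /induced_edge edge_sym. Qed.

Lemma induced_edge_irrefl : irreflexive induced_edge.
Proof. by move=> x; rewrite /induced_edge edge_irrefl. Qed.

Definition induced : sgraph := SGraph induced_edge_sym induced_edge_irrefl.
End Induced.

(* The sum type makes the two vertex sets disjoint. *)
Section Join.
Variables G H : sgraph.

Definition join_edge : rel (G + H)%type := fun a b =>
  match a, b with
  | inl x, inl y => edge x y
  | inr x, inr y => edge x y
  | _, _ => true
  end.

Lemma join_edge_sym : symmetric join_edge.
Proof. by move=> [x|x] [y|y] //=; rewrite edge_sym. Qed.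

Lemma join_edge_irrefl : irreflexive join_edge.
Proof. by move=> [x|x] /=; rewrite edge_irrefl. Qed.

Definition join : sgraph := SGraph join_edge_sym join_edge_irrefl.
End Join.

Section Distance.
Variable G : sgraph.
Implicit Types (u v x : G) (S : {set G}).

(* The vertices of the path are u :: p, so its length is size p. *)
Definition is_path u v (p : seq G) : bool :=
  [&& path (@edge G) u p, last u p == v & uniq (u :: p)].

(* None stands for infinite distance. A path has no repeated vertex, so lengths
   below #|G| are the only possible ones. *)
Definition dist u v : option nat :=
  ohead [seq n <- iota 0 #|G| | [exists p : n.-tuple G, is_path u v p]].

Definition dist_ge (k : nat) u v : bool :=
  if dist u v is Some d then k <= d else true.

Definition on_geodesic u v x : bool :=
  if dist u v is Some d
  then [exists p : d.-tuple G, is_path u v p && (x \in u :: p)]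
  else false.

Definition general_position S : bool :=
  [forall x in S, forall u in S, forall v in S,
    [&& u != x, v != x & u != v] ==> ~~ on_geodesic u v x].

Definition gp : nat := \max_(S : {set G} | general_position S) #|S|.
End Distance.

Section Invariants.
Variable G : sgraph.
Implicit Types (Q S : {set G}) (F : {set {set G}}).

Definition complete Q : bool :=
  (Q != set0) && [forall x in Q, forall y in Q, (x != y) ==> edge x y].

Definition omega : nat := \max_(Q : {set G} | complete Q) #|Q|.

Definition independent Q Q' : bool :=
  [forall u in Q, forall u' in Q', dist_ge 2 u u'].

Definition independent_family F : bool :=
  [forall Q in F, complete Q] &&
  [forall Q in F, forall Q' in F, (Q != Q') ==> independent Q Q'].

Definition rho : nat :=
  \max_(F : {set {set G}} | independent_family F) #|cover F|.
End Invariants.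

(* By definition of partition, the blocks of P are nonempty. *)
Definition complete_multipartite (K : sgraph) : bool :=
  [exists P : {set {set K}},
    [&& partition P [set: K], 2 <= #|P| &
        [forall x, forall y, edge x y == (pblock P x != pblock P y)]]].

(* An empty \max is 0. *)
Definition eta (G : sgraph) : nat :=
  \max_(S : {set complement G} | complete_multipartite (induced S)) #|S|.

(* Main.v *)
(** In a graph of diameter at most two, a set is in general position exactly
    when it induces no path on three vertices, i.e. when adjacency-or-equality
    is transitive on it, so that it induces a disjoint union of complete graphs.
    The join of two nonempty graphs has diameter at most two, and such a set
    meeting both sides must be complete, since a vertex of one side would
    otherwise be the centre of a path between two nonadjacent vertices of the
    other.  On one side, the classes of adjacency-or-equality are pairwise
    independent complete subgraphs, and, when there are at least two of them,
    the partite sets of a complete multipartite subgraph of the complement. *)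
Require Import Defs.
From mathcomp Require Import all_boot.

Set Implicit Arguments.
Unset Strict Implicit.
Unset Printing Implicit Defensive.

(** The search that defines [dist] is a minimisation: its first hit is the least length below the
    bound at which a path exists. *)
Lemma ohead_filter_iota (N d : nat) (P : pred nat) :
  (ohead [seq n <- iota 0 N | P n] == Some d) =
  [&& d < N, P d & [forall k : 'I_d, ~~ P k]].
Proof.
(* The start [m] is general because each step of the induction on [N] shifts it by one. *)
have aux m : ohead [seq n <- iota m N | P n] = Some d <->
    [/\ m <= d < m + N, P d & forall k, m <= k < d -> ~~ P k].
  elim: N m => [|N IHN] m /=.
    by split=> // -[/andP[md]]; rewrite addn0 ltnNge md.
  case: ifPn => [Pm|nPm] /=.
    split=> [[<-]|[/andP[md _] _ lt_d]].
      split=> //; first by rewrite leqnn addnS ltnS leq_addr.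
      by move=> k /andP[mk /(leq_ltn_trans mk)]; rewrite ltnn.
    move: md; rewrite leq_eqVlt => /orP[/eqP-> //|md].
    by have := lt_d m; rewrite leqnn md Pm => /(_ isT).
  apply: (iff_trans (IHN _)); rewrite addSnnS; split=> -[/andP[md dN] Pd lt_d]; split=> //.
  - by rewrite dN (ltnW md).
  - move=> k; rewrite leq_eqVlt andb_orl => /orP[/andP[/eqP<- _] //|].
    exact: lt_d.
  - rewrite dN andbT ltn_neqAle md andbT.
    by apply: contraNneq nPm => ->.
  - by move=> k /andP[mk kd]; apply: lt_d; rewrite kd (ltnW mk).
apply/eqP/and3P=> [/aux[]|[dN Pd /forallP lt_d]].
  by rewrite add0n => dN Pd lt_d; split=> //; apply/forallP=> k; rewrite lt_d /=.
by apply/aux; split=> // k kd; exact: (lt_d (Ordinal kd)).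
Qed.

(** * Distances zero, one and two *)

Section ShortDistances.
Variable G : sgraph.
Implicit Types u v x : G.

Definition has_path (n : nat) u v := [exists p : n.-tuple G, is_path u v p].

Lemma edge_neq u v : edge u v -> u != v.
Proof. by apply: contraTneq => ->; rewrite edge_irrefl. Qed.

(** The search bound [#|G|] disappears because a path of length [d] has [d + 1] distinct
    vertices. *)
Lemma dist_eqE u v d :
  (dist u v == Some d) = has_path d u v && [forall k : 'I_d, ~~ has_path k u v].
Proof.
rewrite /dist ohead_filter_iota; case: ltnP => //= leGd; symmetry.
apply: contraTF leGd => /andP[/existsP[p /and3P[_ _ /card_uniqP /= eq_d]] _].
by rewrite -ltnNge -[d in d < _](size_tuple p) -eq_d max_card.
Qed.

Lemma has_path0 u v : has_path 0 u v = (u == v).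
Proof.
apply/existsP/eqP=> [[p]|->]; last by exists [tuple]; rewrite /is_path /= eqxx.
by rewrite tuple0 => /and3P[_ /eqP].
Qed.

Lemma has_path1 u v : has_path 1 u v = edge u v.
Proof.
apply/existsP/idP=> [[p]|uv].
  by case/tupleP: p => a p; rewrite tuple0 /is_path /= andbT => /and3P[ua /eqP<-].
by exists [tuple v]; rewrite /is_path /= uv eqxx inE (edge_neq uv).
Qed.

Lemma is_path2 u v (p : 2.-tuple G) :
  is_path u v p -> exists x, [/\ val p = [:: x; v], edge u x, edge x v & u != v].
Proof.
case/tupleP: p => a p; case/tupleP: p => b p; rewrite tuple0 /is_path /=.
rewrite !inE negb_or !andbT => /and3P[/andP[ua ab] /eqP <- /andP[/andP[_ ub] _]].
by exists a.
Qed.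

Lemma dist_edge u v : edge u v -> dist u v = Some 1.
Proof.
move=> uv; apply/eqP; rewrite dist_eqE has_path1 uv; apply/forallP=> k.
by rewrite ord1 has_path0 edge_neq.
Qed.

Lemma is_path_common_neighbour u v x :
  edge u x -> edge x v -> u != v -> is_path u v [:: x; v].
Proof.
move=> ux xv uv; rewrite /is_path /= ux xv eqxx !inE negb_or uv.
by rewrite !edge_neq.
Qed.

Lemma dist_common_neighbour u v x :
  edge u x -> edge x v -> u != v -> ~~ edge u v -> dist u v = Some 2.
Proof.
move=> ux xv uv nuv; apply/eqP; rewrite dist_eqE; apply/andP; split.
  apply/existsP; exists [tuple x; v]; exact: is_path_common_neighbour.
by apply/forallP=> -[[|[|//]]] /= _; rewrite ?has_path0 ?has_path1.
Qed.

(** Reduces independence of complete subgraphs to equality and adjacency; infinite distance counts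
    as at least two. *)
Lemma dist_ge2 u v : dist_ge 2 u v = (u != v) && ~~ edge u v.
Proof.
have [->|uv] /= := eqVneq u v.
  suff /eqP: dist v v == Some 0 by rewrite /dist_ge => ->.
  by rewrite dist_eqE has_path0 eqxx; apply/forallP=> -[].
have [e|ne] := boolP (edge u v); first by rewrite /dist_ge dist_edge.
rewrite /dist_ge; case: (dist u v) (dist_eqE u v) => // d /(_ d).
rewrite eqxx => /esym/andP[].
by case: d => [|[|d]] //; rewrite ?has_path0 ?has_path1 ?(negPf uv) ?(negPf ne).
Qed.

End ShortDistances.

(** * Clusters and the invariants of a single graph *)

Section Clusters.
Variable G : sgraph.
Implicit Types (u v x : G) (S Q : {set G}).

Definition adjeq : rel G := fun u v => (u == v) || edge u v.

Definition cluster S : bool :=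
  [forall x in S, forall u in S, forall v in S,
    adjeq u x ==> adjeq x v ==> adjeq u v].

(** The common quantity through which [gp], [rho] and [eta] are compared. *)
Definition cluster_number : nat := \max_(S : {set G} | cluster S) #|S|.

Lemma adjeq_refl : reflexive adjeq.
Proof. by move=> x; rewrite /adjeq eqxx. Qed.

Lemma adjeq_sym : symmetric adjeq.
Proof. by move=> x y; rewrite /adjeq eq_sym edge_sym. Qed.

Lemma clusterP S :
  reflect {in S & &, forall x u v, adjeq u x -> adjeq x v -> adjeq u v}
          (cluster S).
Proof.
apply: (iffP 'forall_in_'forall_in_'forall_in_implyP) => [cS x u v|cS x xS].
  by move=> xS uS vS ux; apply/implyP; exact: cS.
by move=> u uS v vS ux; apply/implyP; exact: cS.
Qed.

Lemma cluster_equivalence S :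
  cluster S -> {in S & &, equivalence_rel adjeq}.
Proof.
move=> /clusterP cS x y z xS yS zS; split=> [|xy]; first exact: adjeq_refl.
by apply/idP/idP; [apply: (cS x) => //; rewrite adjeq_sym | exact: (cS y)].
Qed.

Lemma completeP Q :
  reflect (Q != set0 /\ {in Q &, forall x y, adjeq x y}) (complete Q).
Proof.
apply: (iffP andP) => -[Q0 cQ]; split=> //.
  move=> x y xQ yQ; rewrite /adjeq -implyNb.
  exact: (forall_inP (forall_inP cQ x xQ) y yQ).
by do 2!apply/forall_inP=> ? ?; rewrite implyNb; exact: cQ.
Qed.

Lemma complete_cluster Q : complete Q -> cluster Q.
Proof. by case/completeP=> _ cQ; apply/clusterP=> x u v _ uQ vQ _ _; exact: cQ. Qed.

(** A failure of transitivity at [x] gives nonadjacent [u], [v] with common neighbour [x], so [x]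
    lies on a geodesic of length two. *)
Lemma general_position_cluster S : general_position S -> cluster S.
Proof.
move=> gpS; apply/clusterP=> x u v xS uS vS.
move=> /orP[/eqP-> //|ux] /orP[/eqP<-|xv]; first by rewrite /adjeq ux orbT.
rewrite /adjeq -implyNb; apply/implyP=> uv; apply/negPn/negP=> nuv.
have /implyP := forall_inP (forall_inP (forall_inP gpS x xS) u uS) v vS.
rewrite edge_neq // eq_sym edge_neq // uv => /(_ isT)/negP; apply.
rewrite /on_geodesic (dist_common_neighbour ux xv uv nuv).
apply/existsP; exists [tuple x; v].
by rewrite is_path_common_neighbour // !inE eqxx orbT.
Qed.

(** The first hypothesis bounds all distances by two, so a third vertex on a geodesic is the
    midpoint of one of length two, against transitivity. *)
Lemma cluster_general_position S :
  (forall u v, u != v -> ~~ edge u v -> exists x, edge u x && edge x v) ->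
  cluster S -> general_position S.
Proof.
move=> diam2 /clusterP cS; apply/forall_inP=> x xS.
apply/forall_inP=> u uS; apply/forall_inP=> v vS.
apply/implyP=> /and3P[ux vx uv]; rewrite /on_geodesic.
have [e|ne] := boolP (edge u v).
  rewrite dist_edge //; apply/existsP=> -[p /andP[]].
  case/tupleP: p => a p; rewrite tuple0 /is_path /= => /and3P[_ /eqP-> _].
  by rewrite !inE ![x == _]eq_sym (negPf ux) (negPf vx).
have [y /andP[uy yv]] := diam2 u v uv ne.
rewrite (dist_common_neighbour uy yv uv ne); apply/existsP=> -[p /andP[]].
case/is_path2=> a [-> ua av _]; rewrite !inE ![x == _]eq_sym.
rewrite (negPf ux) (negPf vx) orbF /= => /eqP ax; subst a.
have := cS x u v xS uS vS; rewrite /adjeq ua av !orbT (negPf uv) (negPf ne).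
by move=> /(_ isT isT).
Qed.

Lemma gp_diameter2 :
  (forall u v, u != v -> ~~ edge u v -> exists x, edge u x && edge x v) ->
  gp G = cluster_number.
Proof.
move=> diam2; apply: eq_bigl => S; apply/idP/idP.
  exact: general_position_cluster.
exact: cluster_general_position.
Qed.

Lemma leq_cluster S : cluster S -> #|S| <= cluster_number.
Proof. by move=> cS; apply: leq_bigmax_cond. Qed.

Lemma leq_omega Q : {in Q &, forall x y, adjeq x y} -> #|Q| <= omega G.
Proof.
move=> cQ; have [->|Q0] := eqVneq Q set0; first by rewrite cards0.
by apply: leq_bigmax_cond; apply/completeP.
Qed.

(** Asking for pairwise [adjeq] instead of [complete] admits the empty set, which realises the
    default value 0. *)
Lemma omega_witness :
  exists2 Q : {set G}, {in Q &, forall x y, adjeq x y} & #|Q| = omega G.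
Proof.
have [/existsP[Q cQ]|/existsPn nQ] := boolP [exists Q, complete (Q : {set G})].
  have [|Q0 /completeP[_ ?] E] := @eq_bigmax_cond _ (@complete G) (fun Q => #|Q|).
    by apply/card_gt0P; exists Q.
  by exists Q0.
exists set0; first by move=> x y; rewrite inE.
by rewrite cards0 /omega big_pred0 // => Q; apply/negbTE.
Qed.

Lemma rho_cluster_number : rho G = cluster_number.
Proof.
apply/eqP; rewrite eqn_leq; apply/andP; split; apply/bigmax_leqP.
  move=> F /andP[/forall_inP cF /forall_inP iF]; apply: leq_cluster.
  (* Vertices of distinct members are at distance at least two, so an [adjeq] chain stays inside one
     member. *)
  have same A B x y : A \in F -> B \in F -> x \in A -> y \in B ->
      adjeq x y -> A = B.
    move=> AF BF xA yB; apply: contraTeq => AB; rewrite /adjeq negb_or -dist_ge2.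
    have /implyP/(_ AB) := forall_inP (iF A AF) B BF.
    by move=> /forall_inP/(_ x xA)/forall_inP; apply.
  apply/clusterP=> x u v /bigcupP[A AF xA] /bigcupP[B BF uB] /bigcupP[C CF vC].
  move=> ux xv; have BA := same _ _ _ _ BF AF uB xA ux.
  have AC := same _ _ _ _ AF CF xA vC xv.
  have /completeP[_] := cF A AF; apply; first by rewrite -BA.
  by rewrite AC.
(* Conversely, the [adjeq] classes of a cluster form an independent family that covers it. *)
move=> S cS; have eqS := cluster_equivalence cS.
have pS := equivalence_partitionP eqS; set F := equivalence_partition _ _ in pS.
have [/eqP covS tI F0] := and3P pS; rewrite -[in #|S|]covS.
have FS Q x : Q \in F -> x \in Q -> x \in S.
  by move=> QF xQ; rewrite -covS; apply/bigcupP; exists Q.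
apply: (leq_bigmax_cond (F := fun F : {set {set G}} => #|cover F|)).
apply/andP; split; apply/forall_inP=> Q QF.
  apply/completeP; split=> [|x y xQ yQ]; first by apply: contraNneq F0 => <-.
  rewrite -(pblock_equivalence_partition eqS) -/F ?(FS Q) //.
  by rewrite (def_pblock tI QF).
apply/forall_inP=> Q' Q'F; apply/implyP=> QQ'.
apply/forall_inP=> u uQ; apply/forall_inP=> v vQ'.
rewrite dist_ge2 -negb_or -[_ || _]/(adjeq u v); apply: contra QQ'.
rewrite -(pblock_equivalence_partition eqS) -/F ?(FS Q u) ?(FS Q' v) //.
rewrite (def_pblock tI QF uQ) => vQ.
by rewrite -(def_pblock tI QF vQ) (def_pblock tI Q'F vQ').
Qed.

(** Nonadjacency in the complement is [adjeq] in [G], so on [S] the relation [adjeq] means lying in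
    the same partite set. *)
Lemma multipartite_cluster (S : {set complement G}) :
  complete_multipartite (induced S) -> cluster S.
Proof.
case/existsP=> P /and3P[_ _ /forallP eP].
have adjE (a b : induced S) : adjeq (val a) (val b) = (pblock P a == pblock P b).
  have /eqP := forallP (eP a) b; rewrite /edge /= /induced_edge /= /compl_edge.
  by rewrite -negb_or => /negb_inj.
apply/clusterP=> x u v xS uS vS.
pose sub y (yS : y \in S) : induced S := Sub y yS.
rewrite -[u]/(val (sub u uS)) -[x]/(val (sub x xS)) -[v]/(val (sub v vS)).
by rewrite !adjE => /eqP->.
Qed.

(** The [adjeq] classes are the partite sets; the pair [u], [v] ensures that there are at least
    two. *)
Lemma cluster_multipartite (S : {set complement G}) u v :
  cluster S -> u \in S -> v \in S -> ~~ adjeq u v ->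
  complete_multipartite (induced S).
Proof.
move=> cS uS vS nuv; pose R : rel (induced S) := fun a b => adjeq (val a) (val b).
have eqR : {in [set: induced S] & &, equivalence_rel R}.
  by move=> a b c _ _ _; apply: (cluster_equivalence cS); exact: valP.
have pR := equivalence_partitionP eqR.
set P := equivalence_partition R _ in pR.
have [/eqP covR tI _] := and3P pR.
have pbE a b : (pblock P a == pblock P b) = R a b.
  by rewrite eq_pblock ?covR ?inE // (pblock_equivalence_partition eqR) ?inE.
apply/existsP; exists P; rewrite pR /=; apply/andP; split.
  apply/card_gt1P; pose sub y (yS : y \in S) : induced S := Sub y yS.
  exists (pblock P (sub u uS)), (pblock P (sub v vS)).
  by split; rewrite ?pblock_mem ?covR ?inE // pbE.
apply/forallP=> a; apply/forallP=> b; rewrite pbE.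
by rewrite /edge /= /induced_edge /= /compl_edge -negb_or.
Qed.

(** Clusters with at most one class are counted by [omega], all others by [eta]. *)
Lemma eta_cluster_number : maxn (omega G) (eta G) = cluster_number.
Proof.
apply/eqP; rewrite eqn_leq geq_max -andbA; apply/and3P; split; apply/bigmax_leqP.
- by move=> Q /complete_cluster; exact: leq_cluster.
- by move=> S /multipartite_cluster; exact: leq_cluster.
move=> S cS; rewrite leq_max.
have [aS|] := boolP [forall x in S, forall y in S, adjeq x y].
  by rewrite leq_omega // => x y xS yS; exact: (forall_inP (forall_inP aS x xS)).
case/forall_inPn=> u uS /forall_inPn[v vS nuv]; apply/orP; right.
apply: (leq_bigmax_cond (F := fun S : {set complement G} => #|S|)).
exact: cluster_multipartite cS uS vS nuv.
Qed.

End Clusters.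

(** * Clusters of a join *)

Section JoinClusters.
Variables G H : sgraph.

(** Two vertices of one side have every vertex of the other side as a common neighbour. *)
Lemma gp_join : 0 < #|G| -> 0 < #|H| -> gp (join G H) = cluster_number (join G H).
Proof.
move=> /card_gt0P[g _] /card_gt0P[h _]; apply: gp_diameter2.
by case=> u [] v //= _ _; [exists (inr h) | exists (inl g)].
Qed.

Lemma card_join_set (S : {set join G H}) :
  #|S| = #|[set x : G | inl x \in S]| + #|[set y : H | inr y \in S]|.
Proof.
rewrite -sum1_card big_sumType /=; congr (_ + _); rewrite -sum1_card;
  by apply: eq_bigl => x; rewrite inE.
Qed.

Lemma adjeq_inl (x y : G) : adjeq (inl x : join G H) (inl y) = adjeq x y.
Proof. by []. Qed.

Lemma adjeq_inr (x y : H) : adjeq (inr x : join G H) (inr y) = adjeq x y.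
Proof. by []. Qed.

Lemma cluster_number_join :
  cluster_number (join G H) =
  maxn (omega G + omega H) (maxn (cluster_number G) (cluster_number H)).
Proof.
apply/eqP; rewrite eqn_leq !geq_max; apply/and4P; split.
- apply/bigmax_leqP=> S /clusterP cS; rewrite card_join_set.
  set A := [set x | _]; set B := [set y | _].
  have [A0|[a aA]] := set_0Vmem A.
    rewrite A0 cards0 !leq_max (@leq_cluster _ B) ?orbT //.
    apply/clusterP=> x u v; rewrite !inE => xS uS vS; exact: (cS (inr x) (inr u) (inr v) xS uS vS).
  have [B0|[b bB]] := set_0Vmem B.
    rewrite B0 cards0 addn0 !leq_max (@leq_cluster _ A) ?orbT //.
    apply/clusterP=> x u v; rewrite !inE => xS uS vS; exact: (cS (inl x) (inl u) (inl v) xS uS vS).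
  (* Both sides are met: transitivity through [b] makes [A] complete, and through [a] makes [B]
     complete. *)
  rewrite !inE in aA bB; rewrite leq_max leq_add //; apply: leq_omega => x y.
    by rewrite !inE => xS yS; rewrite -adjeq_inl; exact: (cS (inr b)).
  by rewrite !inE => xS yS; rewrite -adjeq_inr; exact: (cS (inl a)).
(* The union of maximum complete sets of the two sides is complete in the join. *)
- have [Q cQ <-] := omega_witness G; have [Q' cQ' <-] := omega_witness H.
  pose S : {set join G H} :=
    [set z | match z with inl x => x \in Q | inr y => y \in Q' end].
  have -> : #|Q| + #|Q'| = #|S|.
    by rewrite card_join_set; congr (_ + _); apply: eq_card => x; rewrite !inE.
  apply: leq_cluster; apply/clusterP=> x [u|u] [v|v] _; rewrite !inE => uS vS _ _ //.
    by rewrite adjeq_inl cQ.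
  by rewrite adjeq_inr cQ'.
(* A cluster of one side remains a cluster when embedded in the join. *)
- apply/bigmax_leqP=> A /clusterP cA.
  pose S : {set join G H} := [set z | if z is inl x then x \in A else false].
  have -> : #|A| = #|S|.
    rewrite card_join_set [X in _ + X]eq_card0 ?addn0 => [|y]; last by rewrite !inE.
    by apply: eq_card => x; rewrite !inE.
  apply: leq_cluster; apply/clusterP=> -[x|x] [u|u] [v|v]; rewrite !inE //.
  exact: cA.
- apply/bigmax_leqP=> B /clusterP cB.
  pose S : {set join G H} := [set z | if z is inr y then y \in B else false].
  have -> : #|B| = #|S|.
    rewrite card_join_set [X in X + _]eq_card0 => [|x]; last by rewrite !inE.
    by apply: eq_card => y; rewrite !inE.
  apply: leq_cluster; apply/clusterP=> -[x|x] [u|u] [v|v]; rewrite !inE //.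
  exact: cB.
Qed.

End JoinClusters.

Theorem proposition4p2 (G H : sgraph) (hG : 0 < #|G|) (hH : 0 < #|H|) :
  gp (join G H) = maxn (omega G + omega H) (maxn (eta G) (eta H)) /\
  maxn (omega G + omega H) (maxn (eta G) (eta H)) =
    maxn (omega G + omega H) (maxn (rho G) (rho H)).
Proof.
have -> : maxn (omega G + omega H) (maxn (eta G) (eta H)) =
    maxn (omega G + omega H) (maxn (cluster_number G) (cluster_number H)).
  (* Regrouping isolates the maximum of [omega G] and [omega H], which their sum absorbs. *)
  rewrite -!eta_cluster_number maxnACA [RHS]maxnA; congr maxn; apply/esym/maxn_idPl.
  by rewrite geq_max leq_addr leq_addl.
by rewrite !rho_cluster_number gp_join // cluster_number_join.
Qed.
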